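(* Let $I\subset S=K[x_1,\dots,x_n]$ be a monomial ideal, let $I=\bigcap_{i=1}^mQ_i$ be a reduced primary decomposition of $I$, and let $P_i=\sqrt{Q_i}$. Suppose that $G(P_i)\cap G(P_j)=\emptyset$ for all $i\neq j$. Then $\operatorname{sdepth}(S/I)\ge m-1$. In particular, Stanley's conjecture holds for $S/I$, i.e. $\operatorname{depth}_S(S/I)\le\operatorname{sdepth}_S(S/I)$.
   Context: $K$ is a field and $S=K[x_1,\dots,x_n]$ is the polynomial ring, with its standard $\mathbb{Z}^n$-grading. $G(J)$ denotes the set of minimal monomial generators of a monomial ideal $J$ (for a monomial prime ideal, the set of variables generating it; associated primes of monomial ideals are monomial primes). A primary decomposition is reduced if it is irredundant and the radicals $\sqrt{Q_i}$ are pairwise distinct. Let $M$ be a finitely generated $\mathbb{Z}^n$-graded $S$-module. For a homogeneous $u\in M$ and a subset $Z\subset\{x_1,\dots,x_n\}$, $uK[Z]$ denotes the $K$-subspace of $M$ generated by all $uv$, $v$ a monomial in $K[Z]$; if $uK[Z]$ is a free $K[Z]$-module it is called a Stanley space of dimension $|Z|$. A Stanley decomposition of $M$ is a presentation of $M$ as a finite direct sum of $\mathbb{Z}^n$-graded $K$-vector spaces $\mathcal{D}: M=\bigoplus_{i=1}^{s}u_iK[Z_i]$ with each $u_iK[Z_i]$ a Stanley space; $\operatorname{sdepth}\mathcal{D}=\min_i|Z_i|$, and $\operatorname{sdepth} M=\operatorname{sdepth}_S M$ is the maximum of $\operatorname{sdepth}\mathcal{D}$ over all Stanley decompositions $\mathcal{D}$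 of $M$. Stanley's conjecture for $M$ is the inequality $\operatorname{depth} M\le\operatorname{sdepth} M$. *)

(* Defs.v *)
From HB Require Import structures.
From mathcomp Require Import all_boot all_order all_algebra.
From mathcomp Require Import generic_quotient ring_quotient mpoly.
From mathcomp Require Import boolp classical_sets constructive_ereal.

Set Implicit Arguments.
Unset Strict Implicit.
Unset Printing Implicit Defensive.

Import GRing.Theory.

Local Open Scope classical_set_scope.
Local Open Scope ring_scope.
Local Open Scope quotient_scope.

(* R/I as an R-module. *)
Section QuotientModule.
Variables (R : comNzRingType) (I : idealr R).

Definition quotmod : Type := {ideal_quot I}.

HB.instance Definition _ := GRing.Zmodule.on quotmod.

Definition quotmod_pi (f : R) : quotmod := \pi_({ideal_quot I}) f.

Definition quotmod_scale (f : R) (v : quotmod) : quotmod :=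
  (quotmod_pi f : {ideal_quot I}) * (v : {ideal_quot I}).

Fact quotmod_scaleA f g v :
  quotmod_scale f (quotmod_scale g v) = quotmod_scale (f * g) v.
Proof. by rewrite /quotmod_scale /quotmod_pi mulrA -rmorphM. Qed.

Fact quotmod_scale1 : left_id 1 quotmod_scale.
Proof. by move=> v; rewrite /quotmod_scale /quotmod_pi rmorph1 mul1r. Qed.

Fact quotmod_scaleDr : right_distributive quotmod_scale +%R.
Proof. by move=> f u v; rewrite /quotmod_scale mulrDr. Qed.

Fact quotmod_scaleDl v : {morph quotmod_scale^~ v : f g / f + g}.
Proof. by move=> f g; rewrite /quotmod_scale /quotmod_pi rmorphD mulrDl. Qed.

HB.instance Definition _ := GRing.Zmodule_isLmodule.Build R quotmod
  quotmod_scaleA quotmod_scale1 quotmod_scaleDr quotmod_scaleDl.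

End QuotientModule.

Section Ideals.
Variable R : comNzRingType.

Definition ideal_span (A : set R) : set R :=
  [set f | exists s : seq (R * R),
     (forall p, p \in s -> A p.2) /\ f = \sum_(p <- s) p.1 * p.2].

Definition ideal_radical (Q : idealr R) : set R :=
  [set f | exists k : nat, f ^+ k \in (Q : {pred R})].

(* Properness is part of [idealr]. *)
Definition primary_ideal (Q : idealr R) : Prop :=
  forall f g, f * g \in (Q : {pred R}) ->
    f \in (Q : {pred R}) \/ ideal_radical Q g.

Record reduced_primary_decomposition (I : idealr R) (m : nat)
    (Q : 'I_m -> idealr R) : Prop := {
  rpd_inter : forall f,
    f \in (I : {pred R}) <-> forall i, f \in (Q i : {pred R});
  rpd_primary : forall i, primary_ideal (Q i);
  rpd_irredundant : forall i, exists f,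
    (forall j, j != i -> f \in (Q j : {pred R})) /\
    f \notin (Q i : {pred R});
  rpd_distinct : forall i j, i != j ->
    ideal_radical (Q i) <> ideal_radical (Q j)
}.

End Ideals.

Section MonomialIdeals.
Variables (K : fieldType) (n : nat).
Notation S := {mpoly K[n]}.

Definition monomial_ideal (I : idealr S) : Prop :=
  exists A : set 'X_{1..n},
    [set f | f \in (I : {pred S})] = ideal_span [set 'X_[a] | a in A].

(* Exponents of the minimal monomial generators; meant for monomial ideals J. *)
Definition min_gens (J : set S) : set 'X_{1..n} :=
  [set a | J 'X_[a] /\ forall b, J 'X_[b] -> (b <= a)%MM -> b = a].

End MonomialIdeals.

Section Depth.
Variables (K : fieldType) (n : nat) (M : lmodType {mpoly K[n]}).
Notation S := {mpoly K[n]}.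

Definition max_homog_ideal : set S := ideal_span (range (fun i : 'I_n => 'X_i)).

(* (s_0, ..., s_(i-1)) M *)
Definition seq_submod (s : seq S) (i : nat) : set M :=
  [set v | exists w : nat -> M, v = \sum_(j < i) s`_j *: w j].

Definition regular_seq (s : seq S) : Prop :=
  (forall i, (i < size s)%N -> forall v : M,
     seq_submod s i (s`_i *: v) -> seq_submod s i v) /\
  seq_submod s (size s) <> setT.

(* The supremum is taken in the extended integers, where it always exists, so
   that no boundedness of the lengths is presupposed. *)
Definition depth : \bar int :=
  supremum -oo%E [set ((size s)%:Z)%:E |
    s in [set s : seq S | regular_seq s /\
                          forall f, f \in s -> max_homog_ideal f]].

End Depth.

Section StanleyDepth.
Variables (K : fieldType) (n : nat) (M : lmodType {mpoly K[n]}).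
Notation S := {mpoly K[n]}.

(* [gr a] is the component M_a of the Z^n-grading. *)
Variable gr : ('I_n -> int) -> set M.

Definition homogeneous (u : M) : Prop := exists a, gr a u.

(* K[Z] as a subset of S *)
Definition subpoly (Z : {set 'I_n}) : set S :=
  [set p | forall b, b \in msupp p -> forall i, i \notin Z -> b i = 0%N].

Definition cyclic_space (u : M) (Z : {set 'I_n}) : set M :=
  [set p *: u | p in subpoly Z].

(* uK[Z] is free with basis u; in particular u <> 0. *)
Definition stanley_space (u : M) (Z : {set 'I_n}) : Prop :=
  forall p, subpoly Z p -> p *: u = 0 -> p = 0.

Record stanley_decomposition := StanleyDecomposition {
  sd_size : nat;
  sd_gen : 'I_sd_size -> M;
  sd_vars : 'I_sd_size -> {set 'I_n};
  sd_homogeneous : forall i, homogeneous (sd_gen i);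
  sd_free : forall i, stanley_space (sd_gen i) (sd_vars i);
  sd_direct : forall v : M, exists! w : {ffun 'I_sd_size -> M},
    (forall i, cyclic_space (sd_gen i) (sd_vars i) (w i)) /\
    v = \sum_i w i
}.

(* The default value n is an upper bound of all #|Z_i|, so that it only matters
   for the empty decomposition of the zero module. *)
Definition sdepth_dec (D : stanley_decomposition) : nat :=
  \big[minn/n]_(i < sd_size D) #|sd_vars i|.

Definition sdepth : \bar int :=
  supremum -oo%E (range (fun D => ((sdepth_dec D)%:Z)%:E)).

End StanleyDepth.

Section QuotientGrading.
Variables (K : fieldType) (n : nat).
Notation S := {mpoly K[n]}.

Definition poly_grading (a : 'I_n -> int) : set S :=
  [set f | forall b, b \in msupp f -> forall i, a i = (b i)%:Z].

(* The grading induced on S/I; it is one when I is a monomial ideal. *)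
Definition quot_grading (I : idealr S) (a : 'I_n -> int) : set (quotmod I) :=
  [set quotmod_pi I f | f in poly_grading a].

End QuotientGrading.

Arguments quot_grading {K n} I a _.

(* Main.v *)
Require Import Defs.
From HB Require Import structures.
From mathcomp Require Import all_boot all_order all_algebra.
From mathcomp Require Import generic_quotient ring_quotient mpoly.
From mathcomp Require Import boolp classical_sets constructive_ereal.

Import Order.TTheory GRing.Theory Num.Theory.

Local Open Scope classical_set_scope.
Local Open Scope ring_scope.

Set Implicit Arguments.
Unset Strict Implicit.

(** Let G_i be the set of variables of the radical of Q_i, let F be the set of
variables lying in no G_i, and k := (m - 1) + #|F|.  Both claims follow from
depth (S/I) <= k <= sdepth (S/I).

Reduction to monomials.  If X_d is not in the radical of Q_i then it is a
nonzerodivisor modulo Q_i; so whether X^a is in Q_i depends only on the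
exponents of a at G_i.  The variables of G_i are minimal generators of the
radical, so the G_i are disjoint, and a polynomial is in I exactly when each
of its monomials is in every Q_i.  No G_i is empty unless m = 1: if G_j is
empty, no monomial is in Q_j, so I = 0; a product of nonzero elements of the
Q_i would be a nonzero element of I, so some Q_i is 0, and irredundancy leaves
no other component.  [decomposition_components] collects these facts in the
record [monomial_components], and the rest of the argument uses only them.

Lower bound for sdepth.  Choose one variable v_j in each G_j, and sort the
monomials outside I by the first i such that Q_i misses them.  In the class of
i the k variables of F and the v_j (j <> i) are free directions: multiplying
by one of them stays in the class, because it only helps membership in Q_j
(j <> i) and does not affect Q_i.  Each class is therefore a disjoint union of
orthants in those directions, and truncating the other exponents at a large N
makes the union finite at the cost of freeing more variables
([components_sdepth]).

Upper bound for depth.  If f is an element of the homogeneous maximal ideal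
and is regular on M, then a nonzero Koszul cohomology class of degree k on M
yields one of degree k - 1 on M/fM, because f acts on Koszul cohomology as
zero; in degree 0 such an f cannot exist.  So a nonzero class of degree k
bounds the length of regular sequences by k ([size_regular_seq]).  For
M = S/I, let X^u be a monomial outside all Q_i in the variables outside F,
with X_d X^u in Q_i for d in G_i, and let theta_i be the sum of X_d e_d over
d in G_i.  The class is X^u times the product of the e_f (f in F) and of all
the theta_i but one; the product with the last theta_i lies in I.  It is
nonzero because, read off at the squarefree multiples of X^u in the variables
v_j, it is a generator of the top cohomology of the boundary of a simplex with
m vertices ([koszul_class]). *)

(** * Cochains and multiplication by a 1-form *)

Section Wedge.
Variables (R : comNzRingType) (M : lmodType R) (T : eqType).
Implicit Types (w : T -> R) (c d : seq T -> M) (s t : seq T).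

(** The exterior product of the 1-form with coefficients [w] and of the cochain
[c], evaluated at the basis vectors listed in [s].  Cochains are arbitrary
functions on sequences, of all degrees at once and not necessarily
alternating: the identities below hold in this generality, and no sign of a
permutation ever has to be computed. *)
Fixpoint wedge w c s {struct s} : M :=
  if s is j :: t then w j *: c t - wedge w (fun t' => c (j :: t')) t else 0.

Definition subgroup_set (N : set M) : Prop :=
  N 0 /\ forall x y, N x -> N y -> N (x - y).

(** The value at [s] is a signed sum of the terms [w j *: c t], where [t] is [s]
with one occurrence of [j] removed.  Vanishing, locality and membership in an
ideal are all instances. *)
Lemma wedge_in (N : set M) w c s : subgroup_set N ->
  (forall j t, perm_eq s (j :: t) -> N (w j *: c t)) -> N (wedge w c s).
Proof.
move=> [N0 NB]; elim: s c => [|i s IH] c H //=.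
apply: (NB); first exact: H.
apply: IH => j t st; apply: H.
apply: (@perm_trans _ (i :: j :: t)); first by rewrite perm_cons.
by apply/permP => p /=; rewrite addnCA.
Qed.

Lemma subgroup_set0 : subgroup_set [set 0 : M].
Proof. by split => // x y /= -> ->; rewrite subrr. Qed.

Lemma wedge_eq0 w c s :
  (forall j t, perm_eq s (j :: t) -> w j *: c t = 0) -> wedge w c s = 0.
Proof. exact: (@wedge_in [set 0]) subgroup_set0. Qed.

Lemma wedgeB w c d s :
  wedge w (fun t => c t - d t) s = wedge w c s - wedge w d s.
Proof.
elim: s c d => [|j s IH] c d /=; first by rewrite subr0.
by rewrite IH scalerBr !opprB addrACA [RHS]addrACA [in RHS](addrC (- _)).
Qed.

Lemma eq_wedge w c d s :
  (forall t, size s = (size t).+1 -> {subset t <= s} -> c t = d t) ->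
  wedge w c s = wedge w d s.
Proof.
move=> E; apply/eqP; rewrite -subr_eq0 -wedgeB; apply/eqP/wedge_eq0 => j t st.
rewrite E ?subrr ?scaler0 //; first by rewrite (perm_size st).
by move=> x xt; rewrite (perm_mem st) inE xt orbT.
Qed.

Lemma wedgeZ a w c s : wedge w (fun t => a *: c t) s = a *: wedge w c s.
Proof.
elim: s c => [|j s IH] c /=; first by rewrite scaler0.
by rewrite IH scalerBr !scalerA mulrC.
Qed.

Lemma wedgeD w c d s :
  wedge w (fun t => c t + d t) s = wedge w c s + wedge w d s.
Proof.
elim: s c d => [|j s IH] c d /=; first by rewrite addr0.
by rewrite IH scalerDr opprD addrACA.
Qed.

Lemma wedge_sum (J : Type) (r : seq J) w (c : J -> seq T -> M) s :
  wedge w (fun t => \sum_(k <- r) c k t) s = \sum_(k <- r) wedge w (c k) s.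
Proof.
elim: r => [|k r IH].
  by rewrite big_nil wedge_eq0 // => j t _; rewrite big_nil scaler0.
rewrite big_cons -IH -wedgeD; congr (wedge w _ s); apply: funext => t.
by rewrite big_cons.
Qed.

Lemma wedge_weightD w w' c s :
  wedge (fun j => w j + w' j) c s = wedge w c s + wedge w' c s.
Proof.
elim: s c => [|j s IH] c /=; first by rewrite addr0.
by rewrite IH scalerDl opprD addrACA.
Qed.

Lemma wedge_weight_sum (J : Type) (r : seq J) (w : J -> T -> R) c s :
  wedge (fun j => \sum_(k <- r) w k j) c s = \sum_(k <- r) wedge (w k) c s.
Proof.
elim: r => [|k r IH].
  by rewrite big_nil wedge_eq0 // => j t _; rewrite big_nil scale0r.
rewrite big_cons -IH -wedge_weightD; congr wedge.
by apply: funext => j; rewrite big_cons.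
Qed.

Lemma wedge_weightZ a w c s :
  wedge (fun j => a * w j) c s = a *: wedge w c s.
Proof.
elim: s c => [|j s IH] c /=; first by rewrite scaler0.
by rewrite IH scalerBr scalerA.
Qed.

(** 1-forms anticommute. *)
Lemma wedgeC w w' c s : wedge w (wedge w' c) s = - wedge w' (wedge w c) s.
Proof.
elim: s c => [|j s IH] c /=; first by rewrite oppr0.
by rewrite !wedgeB !wedgeZ IH !opprB addrA.
Qed.

Lemma wedgeK w c s : wedge w (wedge w c) s = 0.
Proof.
elim: s c => [|j s IH] c //=.
by rewrite wedgeB wedgeZ IH subr0 subrr.
Qed.

(** The product of the 1-forms [w k], for [k] in [l], with the cochain [c]. *)
Fixpoint wedges (J : Type) (w : J -> T -> R) (l : seq J) c : seq T -> M :=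
  if l is k :: l' then wedge (w k) (wedges w l' c) else c.

Lemma wedge_wedges (J : eqType) (w : J -> T -> R) l c k s :
  k \in l -> wedge (w k) (wedges w l c) s = 0.
Proof.
elim: l s => [|i l IH] s //=; rewrite inE; case: (eqVneq k i) => [-> _|_ /= kl].
  exact: wedgeK.
rewrite wedgeC wedge_eq0 ?oppr0 // => j t _.
by rewrite IH ?scaler0.
Qed.

Lemma wedges_cons0 (J : eqType) (w : J -> T -> R) l c j s :
  (forall k, k \in l -> w k j = 0) -> (forall t, c (j :: t) = 0) ->
  wedges w l c (j :: s) = 0.
Proof.
elim: l s => [|i l IH] s wj0 c0 //=.
rewrite wj0 ?mem_head // scale0r sub0r wedge_eq0 ?oppr0 // => i' t _.
by rewrite IH ?scaler0 // => k kl; rewrite wj0 // inE kl orbT.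
Qed.

Lemma wedges_in (J : eqType) (w : J -> T -> R) (N : set M) l c :
  subgroup_set N -> (forall s, N (c s)) ->
  (forall k j x, k \in l -> N x -> N (w k j *: x)) ->
  forall s, N (wedges w l c s).
Proof.
move=> Ngrp Nc; elim: l => [|k l IH] Nw s //=.
apply: wedge_in => // j t _; apply: (Nw); first exact: mem_head.
by apply: IH => k' j' x k'l; apply: Nw; rewrite inE k'l orbT.
Qed.

End Wedge.

(** Cartan's formula: contraction by [g] and the product with [w] anticommute up
to multiplication by the pairing of [g] and [w]. *)
Lemma sum_wedge_cons (R : comNzRingType) (M : lmodType R) (T : finType)
    (g w : T -> R) (c : seq T -> M) s :
  \sum_j g j *: wedge w c (j :: s) =
  (\sum_j g j * w j) *: c s - wedge w (fun t => \sum_j g j *: c (j :: t)) s.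
Proof.
rewrite wedge_sum scaler_suml -sumrB; apply: eq_bigr => j _ /=.
by rewrite wedgeZ scalerBr scalerA.
Qed.

(** * Koszul cohomology bounds the length of regular sequences *)

Section Koszul.
Variables (K : fieldType) (n : nat) (M : lmodType {mpoly K[n]}).
Notation S := {mpoly K[n]}.

Notation X_ := (fun j : 'I_n => 'X_j : S).

Definition submodule_set (N : set M) : Prop :=
  subgroup_set N /\ forall (f : S) v, N v -> N (f *: v).

(** The Koszul cohomology of M/N with respect to the variables is nonzero in
degree [k].  Representatives in M are used in place of the quotient module, so
that N can vary along a regular sequence. *)
Definition koszul_nonzero (k : nat) (N : set M) : Prop :=
  exists c : seq 'I_n -> M,
    (forall s, size s = k.+1 -> N (wedge X_ c s)) /\
    ~ exists b : seq 'I_n -> M,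
        forall s, size s = k -> N (c s - wedge X_ b s).

Lemma max_homog_idealP (f : S) :
  max_homog_ideal f -> exists g : 'I_n -> S, f = \sum_j g j * 'X_j.
Proof.
case=> s []; elim: s f => [|p s IH] f H ->.
  exists (fun=> 0); rewrite big_nil big1 // => j _; exact: mul0r.
rewrite big_cons.
have [|g ->] := IH _ _ (erefl _).
  by move=> q qs; apply: H; rewrite inE qs orbT.
have [i _ <-] := H p (mem_head _ _).
exists (fun j => g j + (if j == i then p.1 else 0)).
rewrite (bigD1 i) //= [in RHS](bigD1 i) //= eqxx mulrDl addrA (addrC (p.1 * _)).
by congr (_ + _); apply: eq_bigr => j /negbTE ->; rewrite addr0.
Qed.

(** By Cartan's formula [f] acts on cohomology as zero, so [f *: c] is the
coboundary of some [b] modulo N.  Modulo N + fM, [b] is a cocycle; if it were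
a coboundary, say [b = wedge X_ a + f *: e] modulo N, then cancelling [f] in
[f *: c = wedge X_ b = f *: wedge X_ e] would make [c] the coboundary of [e].
In other words, [c] is lifted through the connecting homomorphism of
0 -> M/N -> M/N -> M/(N + fM) -> 0. *)
Lemma koszul_nonzero_quotient (N N' : set M) (f : S) k :
  submodule_set N -> max_homog_ideal f ->
  (forall v, N (f *: v) -> N v) ->
  (forall v, N' v <-> exists e, N (v - f *: e)) ->
  koszul_nonzero k N -> exists2 k', k = k'.+1 & koszul_nonzero k' N'.
Proof.
move=> [Ngrp NZ] /max_homog_idealP [g fE] freg N'E [c [cN cbd]].
have [N0 NB] := Ngrp.
pose b s := \sum_j g j *: c (j :: s).
have bE s : size s = k -> N (f *: c s - wedge X_ b s).
  move=> sk; rewrite fE -sum_wedge_cons.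
  have ND u v : N u -> N v -> N (u + v).
    move=> Nu Nv; rewrite -[v]opprK -[- v]sub0r.
    by apply: (NB) => //; apply: NB.
  by elim/big_ind: _ => // j _; apply/NZ/cN; rewrite /= sk.
(* In degree 0 there are no coboundaries, so [f] kills [c [::]]. *)
case: k cN cbd bE => [|k] cN cbd bE.
  case: cbd; exists (fun=> 0) => s /size0nil ->; rewrite /= subr0.
  by apply: freg; have := bE [::] erefl; rewrite /= subr0.
exists k => //; exists b; split.
  move=> s sk; apply/N'E; exists (c s); rewrite -opprB -sub0r.
  by apply: NB => //; exact: bE.
case=> a aE; case: cbd.
have {}aE s : exists e, size s = k -> N (b s - wedge X_ a s - f *: e).
  have [/aE/N'E[e He]|] := pselect (size s = k); first by exists e.
  by exists 0.
have [e eN] := choice aE.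
exists e => s sk; apply: freg.
have : N (wedge X_ (fun t => b t - wedge X_ a t - f *: e t) s).
  apply: wedge_in => // j t st; apply/NZ/eN.
  by move: (perm_size st); rewrite sk => -[].
rewrite !wedgeB wedgeK subr0 wedgeZ scalerBr => bN.
suff -> : f *: c s - f *: wedge X_ e s =
  (f *: c s - wedge X_ b s) - (0 - (wedge X_ b s - f *: wedge X_ e s)).
  by apply: (NB); [exact: bE | exact: NB].
by rewrite sub0r opprK addrA subrK.
Qed.

Lemma submodule_seq_submod (s : seq S) i :
  submodule_set (@seq_submod _ _ M s i).
Proof.
split; first split.
- by exists (fun=> 0); rewrite big1 // => j _; rewrite scaler0.
- move=> _ _ [w ->] [w' ->]; exists (fun j => w j - w' j).
  by rewrite -sumrB; apply: eq_bigr => j _; rewrite scalerBr.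
- move=> f _ [w ->]; exists (fun j => f *: w j).
  by rewrite scaler_sumr; apply: eq_bigr => j _; rewrite !scalerA mulrC.
Qed.

Lemma seq_submodS (s : seq S) i (v : M) :
  seq_submod s i.+1 v <-> exists e, seq_submod s i (v - s`_i *: e).
Proof.
split=> [[w ->]|[e [w vE]]].
  by exists (w i); exists w; rewrite big_ord_recr /= addrK.
exists (fun j => if j == i then e else w j).
rewrite big_ord_recr /= eqxx -[LHS](subrK (s`_i *: e)) vE; congr (_ + _).
by apply: eq_bigr => j _; rewrite ltn_eqF.
Qed.

Lemma size_regular_seq (s : seq S) k :
  @regular_seq _ _ M s -> (forall f, f \in s -> max_homog_ideal f) ->
  koszul_nonzero k [set 0] -> (size s <= k)%N.
Proof.
move=> [sreg _] smax nz.
suff H i : (i <= size s)%N ->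
    (i <= k)%N /\ koszul_nonzero (k - i) (@seq_submod _ _ M s i).
  by have [] := H _ (leqnn _).
elim: i => [_|i IH lis].
  split => //; rewrite subn0; congr koszul_nonzero : nz.
  apply/seteqP; split => [v /= ->|v [w ->]] /=; last by rewrite big_ord0.
  by exists (fun=> 0); rewrite big_ord0.
have [_ nzi] := IH (ltnW lis).
have [k' kE nz'] := koszul_nonzero_quotient (submodule_seq_submod s i)
  (smax _ (mem_nth 0 lis)) (sreg _ lis) (seq_submodS s i) nzi.
have lik : (i < k)%N by rewrite -subn_gt0 kE.
by split => //; rewrite subnS kE.
Qed.

End Koszul.

(** * The monomials of the components *)

(** What the argument needs to know about the decomposition: [B i] is the set of
exponents of the monomials of the i-th component, and [G i] the set of
variables of its radical. *)
Record monomial_components (K : fieldType) (n : nat) (I : idealr {mpoly K[n]})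
    (m : nat) (G : 'I_m -> {set 'I_n}) (B : 'I_m -> set 'X_{1..n}) : Prop := {
  mc_ideal : forall f : {mpoly K[n]}, f \in (I : {pred _}) <->
    forall b, b \in msupp f -> forall i, B i b;
  mc_local : forall i (a b : 'X_{1..n}),
    (forall d, d \in G i -> (a d <= b d)%N) -> B i a -> B i b;
  mc_proper : forall i, ~ B i 0%MM;
  mc_power : exists N, forall i d, d \in G i -> B i (U_(d) *+ N)%MM;
  mc_disjoint : forall i j d, d \in G i -> d \in G j -> i = j;
  mc_nonempty : (forall i, exists d, d \in G i) \/ m = 1%N
}.

Definition free_vars (n m : nat) (G : 'I_m -> {set 'I_n}) : {set 'I_n} :=
  [set d | [forall i, d \notin G i]]%SET.

Section Socle.
Variables (K : fieldType) (n : nat) (I : idealr {mpoly K[n]}) (m : nat).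
Variables (G : 'I_m -> {set 'I_n}) (B : 'I_m -> set 'X_{1..n}).
Hypothesis mc : monomial_components I G B.
Notation S := {mpoly K[n]}.
Notation F := (free_vars G).

Lemma free_varsN i d : d \in G i -> d \notin F.
Proof.
by move=> di; rewrite inE negb_forall; apply/existsP; exists i; rewrite di.
Qed.

Lemma not_free_vars d : d \notin F -> exists i, d \in G i.
Proof. by rewrite inE negb_forall => /existsP[i]; rewrite negbK; exists i. Qed.

Lemma mc_le i a b : (a <= b)%MM -> B i a -> B i b.
Proof. by move=> /mnm_lepP ab; apply: (mc_local mc) => d _. Qed.

Lemma mcoeff_ideal f b :
  f \in (I : {pred S}) -> ~ (forall i, B i b) -> f@_b = 0.
Proof.
move=> /(mc_ideal mc) fI nb; apply/eqP; rewrite mcoeff_eq0; apply/negP => bf.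
by apply: nb; exact: fI.
Qed.

(** A monomial of maximal degree among those in the variables outside F that are
missed by all components: multiplying it by a variable of [G i] must put it in
some component, and only the i-th one can tell the difference. *)
Lemma mc_socle : exists u : 'X_{1..n},
  [/\ forall d, d \in F -> u d = 0%N, forall i, ~ B i u &
      forall i d, d \in G i -> B i (u + U_(d))%MM].
Proof.
have [N BN] := mc_power mc.
pose P (u : 'X_{1..n}) := (forall d, d \in F -> u d = 0%N) /\ forall i, ~ B i u.
have Pbd u : P u -> (mdeg u <= n * N)%N.
  move=> [uF uB]; rewrite mdegE -[n in (n * N)%N]card_ord -sum_nat_const.
  apply: leq_sum => d _; rewrite leqNgt; apply/negP => Nu.
  have /not_free_vars[i di] : d \notin F.
    by apply/negP => /uF ud; rewrite ud in Nu.
  apply: (uB i); apply: (mc_local mc) (BN i d di) => d' _.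
  rewrite mulmnE mnm1E; case: eqVneq => [<-|_] //.
  by rewrite mul1n ltnW.
pose Q k := `[< exists2 u, P u & mdeg u = k >].
have Q0 : exists k, Q k.
  exists 0%N; apply/asboolP; exists 0%MM; last exact: mdeg0.
  by split=> [d _|i]; [rewrite mnm0E | exact: (mc_proper mc)].
have Qbd k : Q k -> (k <= n * N)%N.
  by move=> /asboolP[u Pu <-]; exact: Pbd.
case: (ex_maxnP Q0 Qbd) => _ /asboolP[u [uF uB] <-] umax.
exists u; split => // i d di; apply: contrapT => nB.
suff : (mdeg (u + U_(d))%MM <= mdeg u)%N by rewrite mdegD mdeg1 addn1 ltnn.
apply: umax; apply/asboolP; exists (u + U_(d))%MM => //; split=> [e eF|j Bj].
  rewrite mnmDE uF // mnm1E; case: eqVneq => // de.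
  by rewrite de in di; have := free_varsN di; rewrite eF.
have [ij|ij] := eqVneq i j; first by rewrite -ij in Bj.
apply: (uB j); apply: (mc_local mc) Bj => e ej.
rewrite mnmDE mnm1E; case: eqVneq => [de|]; last by rewrite addn0.
by rewrite -de in ej; rewrite (mc_disjoint mc di ej) eqxx in ij.
Qed.

End Socle.

Section QuotientWedge.
Variables (R : comNzRingType) (I : idealr R).

Lemma quotmod_piB f g : quotmod_pi I (f - g) = quotmod_pi I f - quotmod_pi I g.
Proof. exact: (@rmorphB R {ideal_quot I}). Qed.

Lemma quotmod_piM f g : quotmod_pi I (f * g) = f *: quotmod_pi I g.
Proof. exact: (@rmorphM R {ideal_quot I}). Qed.

Lemma quotmod_pi0 : quotmod_pi I 0 = 0.
Proof. exact: (@rmorph0 R {ideal_quot I}). Qed.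

Lemma quotmod_pi_eq0 f : quotmod_pi I f = 0 <-> f \in (I : {pred R}).
Proof.
rewrite -[f in f \in _]subr0 Quotient.idealrBE -quotmod_pi0.
by split=> [/eqP|/eqP].
Qed.

Lemma quotmod_pi_surj (v : quotmod I) : exists f, v = quotmod_pi I f.
Proof. by exists (repr (v : {ideal_quot I})); rewrite /quotmod_pi reprK. Qed.

Lemma wedge_quotmod_pi (T : eqType) (w : T -> R) (c : seq T -> R) s :
  wedge w (fun t => quotmod_pi I (c t)) s =
  quotmod_pi I (@wedge _ R^o _ w c s).
Proof.
elim: s c => [|j s IH] c /=; first by rewrite quotmod_pi0.
by rewrite IH quotmod_piB quotmod_piM.
Qed.

End QuotientWedge.

(** * A nonzero Koszul class on S/I *)

(** The recursion step of [wedge] on the regular module, with the module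
operations replaced by those of the ring so that ring lemmas rewrite them. *)
Lemma wedge_regular_cons (R : comNzRingType) (T : eqType) (w : T -> R)
    (c : seq T -> R) j s :
  @wedge _ R^o _ w c (j :: s) =
  w j * c s - @wedge _ R^o _ w (fun t => c (j :: t)) s :> R.
Proof. by []. Qed.

Lemma subgroup_set_msupp (R : comNzRingType) (n : nat) (P : set 'X_{1..n}) :
  @subgroup_set _ {mpoly R[n]}^o
    [set f : {mpoly R[n]} | forall b, b \in msupp f -> P b].
Proof.
split=> [b|f g fP gP b bfg]; first by rewrite msupp0.
by have := @msuppB_le _ _ f g b bfg; rewrite mem_cat => /orP[/fP|/gP].
Qed.

Lemma msupp_wedge (R : comNzRingType) (n : nat) (P : set 'X_{1..n})
    (T : eqType) (w : T -> {mpoly R[n]}) (c : seq T -> {mpoly R[n]}) s :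
  (forall j t b, perm_eq s (j :: t) -> b \in msupp (w j * c t) -> P b) ->
  forall b, b \in msupp (@wedge _ {mpoly R[n]}^o _ w c s) -> P b.
Proof.
move=> H.
apply: wedge_in (subgroup_set_msupp R P) _ => j t st b.
exact: H st.
Qed.

Lemma msupp_wedges (R : comNzRingType) (n : nat) (P : set 'X_{1..n})
    (T J : eqType) (w : J -> T -> {mpoly R[n]}) l (c : seq T -> {mpoly R[n]}) :
  (forall s b, b \in msupp (c s) -> P b) ->
  (forall k j f, k \in l -> (forall b, b \in msupp f -> P b) ->
     forall b, b \in msupp (w k j * f) -> P b) ->
  forall s b, b \in msupp (@wedges _ {mpoly R[n]}^o _ _ w l c s) -> P b.
Proof.
move=> cP wP s.
exact: wedges_in (subgroup_set_msupp R P) _ _ _.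
Qed.

Section KoszulClass.
Variables (K : fieldType) (n : nat) (I : idealr {mpoly K[n]}) (m : nat).
Variables (G : 'I_m -> {set 'I_n}) (B : 'I_m -> set 'X_{1..n}).
Hypothesis mc : monomial_components I G B.
Notation S := {mpoly K[n]}.
Notation F := (free_vars G).
Notation X_ := (fun j : 'I_n => 'X_j : S).

Definition mnm_seq (s : seq 'I_n) : 'X_{1..n} := (\sum_(j <- s) U_(j))%MM.

Lemma mnm_seqE s d : mnm_seq s d = count_mem d s.
Proof.
rewrite mnm_sumE; elim: s => [|j s IH]; first by rewrite big_nil.
by rewrite big_cons IH mnm1E.
Qed.

(** Reading the value at [s] off at [u] plus the multidegree of [s] turns the
Koszul differential into the simplicial coboundary over K.  The vertices in
[t] contribute nothing, as X_d does not divide the monomial read off when [d]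
is in [t]. *)
Lemma mcoeff_wedge (u : 'X_{1..n}) (h : seq 'I_n -> S) s t :
  (forall d, d \in t -> (u + mnm_seq s)%MM d = 0%N) ->
  (@wedge _ S^o _ X_ h (s ++ t))@_(u + mnm_seq s) =
  @wedge _ K^o _ (fun=> 1) (fun s' => (h (s' ++ t))@_(u + mnm_seq s')) s.
Proof.
elim: s u h => [|j s IH] u h ut.
  rewrite /mnm_seq big_nil addm0 in ut *.
  apply/eqP; rewrite mcoeff_eq0; apply/negP.
  move=> /(@msupp_wedge _ _ (fun b => b <> u)); apply=> // j s b ts.
  have jt : j \in t by rewrite (perm_mem ts) mem_head.
  rewrite mulrC (perm_mem (msuppMX _ _)) => /mapP[b' _ ->] E.
  by have := ut j jt; rewrite -E mnmDE mnm1E eqxx.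
have -> : mnm_seq (j :: s) = (U_(j) + mnm_seq s)%MM.
  by rewrite /mnm_seq big_cons.
rewrite cat_cons !wedge_regular_cons mcoeffB addmA; congr (_ - _).
  rewrite mul1r mulrC -addmA addmC -addmA mcoeffMX.
  by rewrite addmC.
rewrite IH; last first.
  by move=> d /ut <-; rewrite /mnm_seq big_cons !mnmDE addnA.
apply: (@eq_wedge _ K^o) => s' _ _.
by rewrite /mnm_seq big_cons addmA.
Qed.

Variable u : 'X_{1..n}.
Hypothesis uF : forall d, d \in F -> u d = 0%N.
Hypothesis uB : forall i, ~ B i u.
Hypothesis uG : forall i d, d \in G i -> B i (u + U_(d))%MM.
Variable i0 : 'I_m.

(** The forms theta_i and e_f. *)
Definition koszul_form (k : 'I_m + 'I_n) (j : 'I_n) : S :=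
  match k with
  | inl i => if j \in G i then 'X_j else 0
  | inr f => (j == f)%:R
  end.

Definition base_cochain (s : seq 'I_n) : S^o := if s is [::] then 'X_[u] else 0.

Definition koszul_forms (r : seq 'I_m) : seq ('I_m + 'I_n) :=
  map inl r ++ map inr (enum F).

(** The Koszul differential is the sum of the theta_i and of the X_f e_f. *)
Lemma X_koszul_form j :
  'X_j = \sum_i koszul_form (inl i) j +
         \sum_(f in F) 'X_f * koszul_form (inr f) j.
Proof.
have [jF|/not_free_vars[i ji]] := boolP (j \in F).
  rewrite big1 ?add0r => [|i _]; last first.
    by rewrite /=; case: ifP => // /free_varsN; rewrite jF.
  rewrite (bigD1 j) //= eqxx mulr1 big1 ?addr0 // => f /andP[_ /negbTE].
  by rewrite eq_sym => ->; rewrite mulr0.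
rewrite (bigD1 i) //= ji big1 ?addr0 => [|i' i'i]; last first.
  case: ifP => // ji'; by rewrite (mc_disjoint mc ji ji') eqxx in i'i.
rewrite big1 ?addr0 // => f fF; case: eqVneq => [jf|]; last by rewrite mulr0.
by move: (free_varsN ji); rewrite jf fF.
Qed.

(** Each factor theta_i multiplies the values by variables of [G i], which puts
them in the i-th component by the choice of [u]. *)
Lemma koszul_forms_values r s b :
  b \in msupp (wedges koszul_form (koszul_forms r) base_cochain s) ->
  (u <= b)%MM /\ forall i, i \in r -> B i b.
Proof.
elim: r s b => [|i r IH] s b; rewrite /koszul_forms /=.
  move: s b; apply: (msupp_wedges (P := fun b => (u <= b)%MM /\
      forall i, i \in [::] -> B i b)).
    case=> [|j t] b; rewrite /= ?msupp0 // msuppX inE => /eqP ->.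
    by split => //; exact: lepm_refl.
  move=> k j f /mapP[d _ ->] fP b /=.
  by case: eqP => _; rewrite ?mul1r ?mul0r ?msupp0 //; exact: fP.
move: b; apply: (@msupp_wedge _ _ (fun b => (u <= b)%MM /\
    forall i', i' \in i :: r -> B i' b)) => j t b _ /=.
case: ifP => [ji|_]; last by rewrite mul0r msupp0.
rewrite mulrC (perm_mem (msuppMX _ _)) => /mapP[b' /IH[ub rb] ->]; split.
  exact: lepm_trans ub (lem_addl _ _).
move=> i'; rewrite inE => /orP[/eqP ->|/rb]; last first.
  by apply: (mc_le mc); exact: lem_addl.
by apply: (mc_le mc) (uG ji); rewrite addmC; apply/mnm_lepP => d;
  by rewrite !mnmDE leq_add2l; move/mnm_lepP: ub.
Qed.

Let r0 := rem i0 (enum 'I_m).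
Let top_class := wedges koszul_form (koszul_forms r0) base_cochain.

Lemma r0E i : (i \in r0) = (i != i0).
Proof. by rewrite mem_rem_uniq ?enum_uniq // !inE mem_enum andbT. Qed.

(** In the decomposition of the differential all summands but theta_i0 occur in
the class already, and a 1-form squares to zero; the product with theta_i0 has
its values in every component. *)
Lemma top_class_cocycle s : @wedge _ S^o _ X_ top_class s \in (I : {pred S}).
Proof.
have -> : @wedge _ S^o _ X_ top_class s =
          wedges koszul_form (koszul_forms (i0 :: r0)) base_cochain s.
  have -> : X_ = fun j => \sum_i koszul_form (inl i) j +
                          \sum_(f <- enum F) 'X_f * koszul_form (inr f) j.
    by apply: funext => j; rewrite big_enum; exact: X_koszul_form.
  rewrite wedge_weightD !wedge_weight_sum (bigD1 i0) // [X in _ + X + _]big1.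
    rewrite addr0 big_seq big1 ?addr0 // => f fF.
    rewrite wedge_weightZ wedge_wedges ?scaler0 //.
    by rewrite mem_cat (map_f inr fF) orbT.
  move=> i ii0; apply: wedge_wedges.
  by rewrite mem_cat map_f // r0E.
apply/(mc_ideal mc) => b /koszul_forms_values[_ H] i; apply: H.
by rewrite inE r0E orbN.
Qed.

Lemma koszul_forms_free :
  wedges koszul_form (koszul_forms [::]) base_cochain (enum F) = 'X_[u].
Proof.
rewrite /koszul_forms /=.
have : {subset enum F <= F} by move=> d; rewrite mem_enum.
have : uniq (enum F) := enum_uniq _.
elim: (enum F) => [|f fs IH] //= /andP[ffs ufs] fsF.
rewrite eqxx scale1r IH => //; last first.
  by move=> d dfs; apply: fsF; rewrite inE dfs orbT.
rewrite wedge_eq0 ?subr0 // => j t _.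
rewrite wedges_cons0 ?scaler0 // => _ /mapP[f' f'fs ->] /=.
by case: eqP => // ff'; rewrite ff' f'fs in ffs.
Qed.

(** With the entries in the order of the factors, only the diagonal term of the
expansion survives: a vertex [v i] is seen by theta_i alone. *)
Lemma koszul_forms_lead r (v : 'I_m -> 'I_n) : uniq r ->
  (forall i, v i \in G i) ->
  wedges koszul_form (koszul_forms r) base_cochain (map v r ++ enum F) =
  'X_[u + mnm_seq (map v r)].
Proof.
move=> ur vG; elim: r ur => [_|i r IH /andP[ir ur]]; rewrite /koszul_forms /=.
  by rewrite koszul_forms_free /mnm_seq big_nil addm0.
rewrite vG IH // wedge_eq0 ?subr0.
  rewrite /GRing.scale /= -mpolyXD; congr 'X_[_].
  by rewrite /mnm_seq big_cons !addmA (addmC u).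
move=> j t _; rewrite wedges_cons0 ?scaler0 // => k.
rewrite mem_cat => /orP[/mapP[i' i'r ->]|/mapP[f fF ->]] /=.
  by case: ifP => // vi; rewrite -(mc_disjoint mc (vG i) vi) (negbTE ir) in i'r.
case: eqP => // vf; rewrite mem_enum -vf in fF.
by have := free_varsN (vG i); rewrite fF.
Qed.

(** Suppose that the class is the coboundary of [b].  Read at the multidegrees
of the faces of the simplex on the [v j], the class becomes a simplicial
coboundary [wedge 1 be]; this is legitimate because the monomials involved
miss some [G i], hence are outside I.  Its own simplicial coboundary at the
whole simplex is then 0.  But it is 1 at the face opposite to [v i0] and 0 at
all other faces. *)
Lemma koszul_class :
  koszul_nonzero (m.-1 + #|F|) [set 0 : quotmod I].
Proof.
have sr0 : size r0 = m.-1 by rewrite size_rem ?mem_enum // size_enum_ord.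
exists (fun s => quotmod_pi I (top_class s)); split => [s _ /=|[b0 bE]].
  by rewrite wedge_quotmod_pi; apply/quotmod_pi_eq0/top_class_cocycle.
have [b bb0] := choice (fun s => quotmod_pi_surj (b0 s)).
have {bE} bE s : size s = (m.-1 + #|F|)%N ->
    top_class s - @wedge _ S^o _ X_ b s \in (I : {pred S}).
  move=> /bE /=; rewrite (_ : b0 = fun s => quotmod_pi I (b s)).
    by rewrite wedge_quotmod_pi -quotmod_piB => /quotmod_pi_eq0.
  exact: funext.
pose e s := (top_class (s ++ enum F))@_(u + mnm_seq s).
pose be s := (b (s ++ enum F))@_(u + mnm_seq s).
have eE s : size s = m.-1 -> (forall d, d \in s -> d \notin F) ->
    ~ (forall i, B i (u + mnm_seq s)%MM) ->
    e s = @wedge _ K^o _ (fun=> 1) be s.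
  move=> ss sF nB; rewrite -mcoeff_wedge; last first.
    move=> d; rewrite mem_enum => dF; rewrite mnmDE uF // mnm_seqE.
    apply/eqP; rewrite -leqn0 leqNgt -has_count has_pred1.
    by apply/negP => /sF; rewrite dF.
  apply/eqP; rewrite -subr_eq0 -mcoeffB; apply/eqP.
  by apply: (mcoeff_ideal mc) nB; apply: bE; rewrite size_cat ss -cardE.
have [[v vG]|m1] : (exists v : 'I_m -> 'I_n, forall i, v i \in G i) \/ m = 1%N.
- case: (mc_nonempty mc) => [/choice[v vG]|m1]; last by right.
  by left; exists v.
- have vinj : injective v.
    by move=> i j vij; apply: (mc_disjoint mc) (vG i) _; rewrite vij.
  pose V := map v (i0 :: r0).
  have VF d : d \in V -> d \notin F.
    by move=> /mapP[i _ ->]; exact: free_varsN (vG i).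
  have := @wedgeK _ K^o _ (fun=> 1) be V.
  rewrite -(@eq_wedge _ K^o _ _ e) => [|t]; last first.
    rewrite [in size V]/= size_map sr0 => -[st] tV; apply: (eE) => //.
      by move=> d /tV /VF.
    move=> Bt.
    have [i vit] : exists i, v i \notin t.
      apply: contrapT => nex.
      have : (size (map v (enum 'I_m)) <= size t)%N.
        apply: uniq_leq_size; first by rewrite map_inj_uniq ?enum_uniq.
        move=> _ /mapP[i _ ->]; apply: contrapT => /negP vit.
        by apply: nex; exists i.
      rewrite size_map size_enum_ord -st; case: (m) i0 => [[]//|m' _].
      by rewrite ltnn.
    apply: (@uB i); apply: (mc_local mc) (Bt i) => d di.
    rewrite mnmDE mnm_seqE (_ : count_mem d t = 0%N) ?addn0 //.
    apply/eqP; rewrite -leqn0 leqNgt -has_count has_pred1; apply/negP => dt.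
    have /mapP[j _ dj] := tV d dt.
    move: di; rewrite dj => /(mc_disjoint mc (vG j)) ji.
    by rewrite -ji -dj dt in vit.
  rewrite /= scale1r wedge_eq0 ?subr0 => [|j t _].
    rewrite /e /top_class koszul_forms_lead ?rem_uniq ?enum_uniq //.
    rewrite mcoeffX eqxx.
    by move/eqP; rewrite oner_eq0.
  rewrite /e /= /top_class wedges_cons0 ?mcoeff0 ?scaler0 // => k.
  rewrite mem_cat => /orP[/mapP[i ir ->]|/mapP[f fF ->]] /=.
    case: ifP => // vi; rewrite r0E in ir.
    by rewrite (mc_disjoint mc (vG i0) vi) eqxx in ir.
  case: eqP => // vf; rewrite mem_enum -vf in fF.
  by have := free_varsN (vG i0); rewrite fF.
(* When m = 1 the class is X^u times the product of the e_f; its value at [F] is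
   X^u, which no Koszul coboundary hits since X^u has no variable in F. *)
have r0nil : r0 = [::] by apply: size0nil; rewrite sr0 m1.
have : e [::] = 0.
  apply: eE => //; first by rewrite m1.
  by rewrite /mnm_seq big_nil addm0 => /(_ i0); exact: uB.
rewrite /e /top_class r0nil koszul_forms_free /mnm_seq big_nil addm0.
rewrite mcoeffX eqxx.
by move/eqP; rewrite oner_eq0.
Qed.

End KoszulClass.

(** * Suprema of sets of natural numbers *)

Section NaturalSuprema.
Variables (T : Type) (D : set T) (f : T -> nat) (k : nat).
Hypothesis fk : forall x, D x -> (f x <= k)%N.
Let E : set (\bar int) := [set ((f x)%:Z)%:E | x in D].

Lemma has_supremum_nat : D !=set0 -> supremums E !=set0.
Proof.
case=> x0 Dx0.
have Q0 : exists l, `[< exists2 x, D x & f x = l >].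
  by exists (f x0); apply/asboolP; exists x0.
have Qk l : `[< exists2 x, D x & f x = l >] -> (l <= k)%N.
  by move=> /asboolP[x Dx <-]; exact: fk.
case: (ex_maxnP Q0 Qk) => l /asboolP[x Dx xl] lmax.
exists (l%:Z)%:E; split=> [_ [y Dy <-]|y].
  by rewrite lee_fin lez_nat; apply: lmax; apply/asboolP; exists y.
by apply; exists x => //; rewrite xl.
Qed.

Lemma supremum_nat_ub x : D x -> (((f x)%:Z)%:E <= supremum -oo%E E)%E.
Proof.
move=> Dx; apply: ge_supremum_Nmem; last by exists x.
by apply: has_supremum_nat; exists x.
Qed.

Lemma supremum_nat_le : (supremum -oo%E E <= (k%:Z)%:E)%E.
Proof.
rewrite /supremum; case: eqVneq => [_|/set0P[_ [x Dx _]]]; first exact: leNye.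
case: xgetP => [y _ [_ yE]|/(_ _)]; last first.
  by have [y yE] := has_supremum_nat (ex_intro _ x Dx); move/(_ y).
by apply: yE => _ [z Dz <-]; rewrite lee_fin lez_nat; exact: fk.
Qed.

End NaturalSuprema.

(** * Decomposing sets of monomials into orthants *)

Section StanleyPieces.
Variable n : nat.
Implicit Types (a b w : 'X_{1..n}) (Z D : {set 'I_n}).

(** The exponent [b] is that of a monomial of [X^a K[Z]]. *)
Definition piece a Z b : bool :=
  (a <= b)%MM && [forall d, (d \notin Z) ==> (a d == b d)].

Lemma pieceP a Z b : reflect
  ((forall d, (a d <= b d)%N) /\ forall d, d \notin Z -> a d = b d)
  (piece a Z b).
Proof.
apply: (iffP andP) => -[/mnm_lepP ab H]; split=> //.
- by move=> d dZ; apply/eqP; move/forallP/(_ d)/implyP: H; apply.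
- by apply/forallP => d; apply/implyP => dZ; apply/eqP/H.
Qed.

Variables (A : set 'X_{1..n}) (D : {set 'I_n}) (N : nat).

Definition agree_off b b' := forall d, d \notin D -> b d = b' d.

Definition cap w : 'X_{1..n} := [multinom minn (w d) N | d < n].

Definition meet_mnm b b' : 'X_{1..n} := [multinom minn (b d) (b' d) | d < n].

(** Membership in [A] is decided on exponents truncated at [N], and the section
of [A] in the directions [D] through any point is empty or an orthant: an
up-set closed under meets. *)
Hypothesis A_cap : forall w, A w <-> A (cap w).
Hypothesis A_up : forall w w', (w <= w')%MM -> agree_off w w' -> A w -> A w'.
Hypothesis A_meet : forall w w', agree_off w w' -> A w -> A w' ->
  A (meet_mnm w w').

(** The corner of a section in the directions [D], above a truncated
exponent. *)
Definition base a : Prop :=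
  [/\ A a, forall d, (a d <= N)%N &
      forall w, agree_off a w -> A w -> (a <= w)%MM].

(** A truncated exponent stands for all larger ones as soon as it equals [N]. *)
Definition base_vars a : {set 'I_n} := (D :|: [set d | a d == N])%SET.

(** Off [D] the base point of a piece is recovered by truncation. *)
Lemma base_vars_free a w d : d \notin D -> piece a (base_vars a) w ->
  (a d <= N)%N -> a d = minn (w d) N.
Proof.
move=> dD /pieceP[aw awE] aN; have := awE d.
rewrite !inE (negbTE dD) /=; case: eqVneq => [aE _|ne /(_ isT) <-].
  by rewrite aE; apply/esym/minn_idPr; rewrite -aE.
by apply/esym/minn_idPl.
Qed.

Lemma piece_base a w : base a -> piece a (base_vars a) w -> A w.
Proof.
move=> [Aa aN _] aw; apply/A_cap; apply: A_up Aa.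
  apply/mnm_lepP => d; rewrite mnmE leq_min aN andbT.
  by case/pieceP: aw.
by move=> d dD; rewrite mnmE; apply: base_vars_free.
Qed.

(** An element of least degree of the section through [cap w] is its corner: its
meet with any other element is in the section and has at least that degree. *)
Lemma base_exists w : A w -> exists2 a, base a & piece a (base_vars a) w.
Proof.
move=> /A_cap Aw.
pose P k := `[< exists a, [/\ A a, agree_off (cap w) a, (a <= cap w)%MM &
                            mdeg a = k] >].
have P0 : exists k, P k.
  exists (mdeg (cap w)); apply/asboolP; exists (cap w); split=> //.
  exact: lepm_refl.
case: (ex_minnP P0) => _ /asboolP[a [Aa wa /mnm_lepP aw <-]] amin.
have aN d : (a d <= N)%N by apply: leq_trans (aw d) _; rewrite mnmE geq_minr.
exists a; first split=> // w' aw' Aw'.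
  have le : (meet_mnm a w' <= a)%MM.
    by apply/mnm_lepP => d; rewrite mnmE geq_minl.
  have : (mdeg a <= mdeg (meet_mnm a w'))%N.
    apply: amin; apply/asboolP; exists (meet_mnm a w'); split=> //.
    - exact: A_meet.
    - by move=> d dD; rewrite [RHS]mnmE -(aw' d dD) minnn; exact: wa.
    - by apply: lepm_trans le _; apply/mnm_lepP.
  have mE : (a = meet_mnm a w' + (a - meet_mnm a w'))%MM by rewrite addmC submK.
  rewrite {1}mE mdegD -[leqRHS]addn0 leq_add2l leqn0 mdeg_eq0 => /eqP d0.
  rewrite mE d0 addm0; apply/mnm_lepP => d; by rewrite mnmE geq_minr.
apply/pieceP; split=> [d|d].
  by apply: leq_trans (aw d) _; rewrite mnmE geq_minl.
rewrite !inE negb_or => /andP[dD adN].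
have : a d = minn (w d) N by rewrite -(wa d dD) mnmE.
by move: adN; case: leqP => // _ /negP + aE; rewrite aE eqxx.
Qed.

Lemma base_unique a a' w : base a -> base a' ->
  piece a (base_vars a) w -> piece a' (base_vars a') w -> a = a'.
Proof.
move=> [Aa aN amin] [Aa' aN' amin'] aw aw'.
have E d : d \notin D -> a d = a' d.
  by move=> dD; rewrite (base_vars_free dD aw) // (base_vars_free dD aw').
have /mnm_lepP le := amin a' E Aa'.
have /mnm_lepP le' := amin' a (fun d dD => esym (E d dD)) Aa.
by apply/mnmP => d; apply/eqP; rewrite eqn_leq le le'.
Qed.

End StanleyPieces.

(** * From a partition of the monomials to a Stanley decomposition *)

Section StanleyDecomposition.
Variables (K : fieldType) (n : nat) (I : idealr {mpoly K[n]}).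
Notation S := {mpoly K[n]}.

Variable C : set 'X_{1..n}.
Hypothesis IE : forall f : S, f \in (I : {pred S}) <->
  forall b, b \in msupp f -> C b.

Lemma subpoly_mulX (p : S) a Z b :
  subpoly Z p -> b \in msupp (p * 'X_[a]) -> piece a Z b.
Proof.
move=> pZ; rewrite (perm_mem (msuppMX _ _)) => /mapP[c cp ->].
apply/pieceP; split=> d; rewrite mnmDE ?leq_addr // => dZ.
by rewrite (pZ c cp d dZ) addn0.
Qed.

Lemma piece_subpoly (f : S) a Z :
  (forall b, b \in msupp f -> piece a Z b) ->
  exists2 p, subpoly Z p & p * 'X_[a] = f.
Proof.
move=> fZ; exists (\sum_(b <- msupp f) f@_b *: 'X_[(b - a)%MM]).
  move=> c /msupp_sum_le /flattenP[_ /mapP[b bf ->]] /msuppZ_le.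
  rewrite msuppX inE => /eqP -> d dZ.
  rewrite mem_filter /= in bf; have /pieceP[_ /(_ d dZ) E] := fZ b bf.
  by rewrite mnmBE E subnn.
rewrite mulr_suml [RHS]mpolyE [RHS]big_seq big_seq; apply: eq_bigr => b bf.
rewrite -scalerAl -mpolyXD submK //.
by case/andP: (fZ b bf).
Qed.

Definition mpoly_restrict (P : pred 'X_{1..n}) (f : S) : S :=
  \sum_(b <- msupp f | P b) f@_b *: 'X_[b].

Lemma mcoeff_restrict P f c :
  (mpoly_restrict P f)@_c = if P c then f@_c else 0.
Proof.
rewrite /mpoly_restrict raddf_sum /=.
rewrite (eq_bigr (fun b => f@_b * (b == c)%:R)); last first.
  by move=> b _; rewrite mcoeffZ mcoeffX.
case: (boolP (c \in msupp f)) => [cf|].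
  rewrite big_mkcond (bigD1_seq c) //= eqxx mulr1 big1 ?addr0 // => b.
  by move=> /negbTE ->; rewrite mulr0 if_same.
rewrite -mcoeff_eq0 => /eqP f0; rewrite f0 if_same big1 // => b _.
by case: eqVneq => [->|_]; rewrite ?f0 ?mul0r ?mulr0.
Qed.

Lemma quotmod_pi_sum (J : finType) (g : J -> S) :
  quotmod_pi I (\sum_j g j) = \sum_j quotmod_pi I (g j).
Proof. exact: (@rmorph_sum S {ideal_quot I}). Qed.

(** The pieces partition the monomials outside I. *)
Variables (J : finType) (a : J -> 'X_{1..n}) (Z : J -> {set 'I_n}).
Hypothesis aC : forall j b, piece (a j) (Z j) b -> ~ C b.
Hypothesis Ca : forall b, ~ C b -> exists j, piece (a j) (Z j) b.
Hypothesis a_uniq : forall i j b,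
  piece (a i) (Z i) b -> piece (a j) (Z j) b -> i = j.

Let s := #|J|.
Let gen (i : 'I_s) : quotmod I := quotmod_pi I 'X_[a (enum_val i)].
Let vars (i : 'I_s) := Z (enum_val i).

Lemma gen_homogeneous i : homogeneous (quot_grading I) (gen i).
Proof.
exists (fun d => (a (enum_val i) d)%:Z); exists 'X_[a (enum_val i)] => //.
by move=> b; rewrite msuppX inE => /eqP ->.
Qed.

Lemma gen_free i : stanley_space (gen i) (vars i).
Proof.
move=> p pZ; rewrite -quotmod_piM => /quotmod_pi_eq0/IE pI.
apply/msuppnil0; case E : (msupp p) => [//|b l].
have bp : (a (enum_val i) + b)%MM \in msupp (p * 'X_[a (enum_val i)]).
  by rewrite (perm_mem (msuppMX _ _)) map_f // E mem_head.
by case: (aC (subpoly_mulX pZ bp)); exact: pI.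
Qed.

(** The component of [f] in a piece is [f] restricted to the monomials of that
piece: modulo I a polynomial is determined by its coefficients outside I, and
distinct pieces have no monomial in common. *)
Lemma gen_direct (v : quotmod I) : exists! w : {ffun 'I_s -> quotmod I},
  (forall i, cyclic_space (gen i) (vars i) (w i)) /\ v = \sum_i w i.
Proof.
have [f ->] := quotmod_pi_surj v.
pose fr i := mpoly_restrict (piece (a (enum_val i)) (vars i)) f.
exists [ffun i => quotmod_pi I (fr i)]; split; first split.
- move=> i; rewrite ffunE.
  have [b|p pZ pE] := @piece_subpoly (fr i) (a (enum_val i)) (vars i).
    rewrite mcoeff_msupp mcoeff_restrict.
    by case: ifP => // _; rewrite eqxx.
  by exists p => //; rewrite -quotmod_piM pE.
- under eq_bigr do rewrite ffunE.
  rewrite -quotmod_pi_sum; apply/eqP; rewrite -subr_eq0 -quotmod_piB.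
  apply/eqP/quotmod_pi_eq0/IE => b; apply: contraPP => /Ca[j jb].
  apply/negP; rewrite -mcoeff_eq0 mcoeffB raddf_sum /= subr_eq0.
  rewrite (bigD1 (enum_rank j)) //= big1 => [|i ij].
    by rewrite /fr mcoeff_restrict /vars enum_rankK jb addr0.
  rewrite /fr mcoeff_restrict; case: ifP => // ib.
  by rewrite -(a_uniq ib jb) enum_valK eqxx in ij.
move=> w [wc vE]; apply/ffunP => i; rewrite ffunE; move: vE.
have /choice[p pE] : forall i, exists p, subpoly (vars i) p /\ p *: gen i = w i.
  by move=> j; have [p] := wc j; exists p.
rewrite (eq_bigr (fun j => quotmod_pi I (p j * 'X_[a (enum_val j)])));
  last first.
  by move=> j _; rewrite quotmod_piM; case: (pE j).
rewrite -quotmod_pi_sum => /eqP; rewrite -subr_eq0 -quotmod_piB.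
move=> /eqP/quotmod_pi_eq0/IE fI.
have -> : w i = quotmod_pi I (p i * 'X_[a (enum_val i)]).
  by rewrite quotmod_piM; case: (pE i).
congr quotmod_pi; apply/mpolyP => b; rewrite mcoeff_restrict.
have supp j : (p j * 'X_[a (enum_val j)])@_b != 0 ->
    piece (a (enum_val j)) (vars j) b.
  by rewrite -mcoeff_msupp; apply: subpoly_mulX; case: (pE j).
case: ifP => ib; last first.
  by apply/esym/eqP; apply: contraFT ib => /supp.
have : (f - \sum_j p j * 'X_[a (enum_val j)])@_b = 0.
  apply/eqP; rewrite mcoeff_eq0; apply/negP => /fI; exact: aC ib.
rewrite mcoeffB raddf_sum /= (bigD1 i) //= big1 ?addr0 => [/eqP|j ji].
  by rewrite subr_eq0 => /eqP.
apply/eqP; apply: contraNT ji => /supp jb.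
by rewrite -(inj_eq enum_val_inj) (a_uniq jb ib).
Qed.

Lemma sdepth_pieces k : (k <= n)%N -> (forall j, (k <= #|Z j|)%N) ->
  ((k%:Z)%:E <= sdepth (quot_grading I))%E.
Proof.
move=> kn kZ.
pose D := StanleyDecomposition gen_homogeneous gen_free gen_direct.
apply: (@le_trans _ _ ((sdepth_dec D)%:Z)%:E).
  rewrite lee_fin lez_nat /sdepth_dec.
  elim/big_ind: _ => //= [x y kx ky|i _]; first by rewrite leq_min kx.
  exact: kZ.
apply: (@supremum_nat_ub _ setT (@sdepth_dec _ _ _ (quot_grading I)) n) => //.
move=> D' _.
rewrite /sdepth_dec; elim/big_ind: _ => //= [x y xn _|i _].
  by rewrite geq_min xn.
by rewrite -[leqRHS]card_ord max_card.
Qed.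

End StanleyDecomposition.

(** * Bounding sdepth and depth *)

Section ComponentsSdepth.
Variables (K : fieldType) (n : nat) (I : idealr {mpoly K[n]}) (m : nat).
Variables (G : 'I_m -> {set 'I_n}) (B : 'I_m -> set 'X_{1..n}).
Hypothesis mc : monomial_components I G B.
Notation F := (free_vars G).

(** The free directions of the class of [i]: the variables of F together with
one variable of each [G j] for [j] other than [i]. *)
Lemma component_directions (i : 'I_m) : exists D : {set 'I_n},
  [/\ forall d, d \in D -> d \notin G i,
      forall j d d', d \in D -> d' \in D -> d \in G j -> d' \in G j -> d = d' &
      (m.-1 + #|F| <= #|D|)%N].
Proof.
case: (mc_nonempty mc) => [/choice[v vG]|m1]; last first.
  exists F; split=> [d|j d d' dF _ /free_varsN|].
  - by apply: contraL; exact: free_varsN.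
  - by rewrite dF.
  - by have -> : m.-1 = 0%N by rewrite m1.
have vinj : injective v.
  by move=> j j' E; apply: (mc_disjoint mc) (vG j) _; rewrite E.
pose V := [set v j | j in [set~ i]]%SET.
have VE d : d \in V -> exists2 j, j != i & d = v j.
  by case/imsetP => j; rewrite !inE => ji ->; exists j.
exists (F :|: V)%SET; split.
- move=> d; rewrite finset.in_setU => /orP[|/VE[j ji ->]].
    by apply: contraL; exact: free_varsN.
  by apply: contra ji => vji; rewrite (mc_disjoint mc (vG j) vji).
- move=> j d d'; rewrite !finset.in_setU => dD d'D dj d'j.
  have {}dD : d \in V by move: dD; rewrite (negbTE (free_varsN dj)).
  have {}d'D : d' \in V by move: d'D; rewrite (negbTE (free_varsN d'j)).
  have [k _ dk] := VE d dD; have [k' _ dk'] := VE d' d'D; subst d d'.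
  by rewrite (mc_disjoint mc (vG k) dj) (mc_disjoint mc (vG k') d'j).
- rewrite cardsU (_ : (F :&: V)%SET = finset.set0); last first.
    apply/setP => d; rewrite finset.in_setI finset.in_set0.
    apply/negP => /andP[dF /VE[j _ dj]].
    by have := free_varsN (vG j); rewrite -dj dF.
  rewrite cards0 subn0 card_imset // cardsC1 card_ord addnC.
  exact: leqnn.
Qed.

Definition first_missed (i : 'I_m) : set 'X_{1..n} :=
  [set w | ~ B i w /\ forall j : 'I_m, (j < i)%N -> B j w].

Lemma first_missed_exists w : ~ (forall i, B i w) -> exists i, first_missed i w.
Proof.
move=> nB; pose P k := `[< exists2 i : 'I_m, ~ B i w & i = k :> nat >].
have P0 : exists k, P k.
  apply: contrapT => nP; apply: nB => i; apply: contrapT => nBi; apply: nP.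
  by exists (i : nat); apply/asboolP; exists i.
case: (ex_minnP P0) => _ /asboolP[i nBi <-] imin.
exists i; split=> // j ji; apply: contrapT => nBj.
have := imin j; rewrite leqNgt ji; move/(_ _)/negP; apply => //.
by apply/asboolP; exists j.
Qed.

Lemma first_missed_unique i j w :
  first_missed i w -> first_missed j w -> i = j.
Proof.
move=> [ni iB] [nj jB]; apply/val_inj/eqP; rewrite eqn_leq.
by apply/andP; split; rewrite leqNgt; apply/negP; [move/iB|move/jB].
Qed.

(** Beyond an exponent N at which the powers of all variables of [G i] are in
the i-th component, raising an exponent changes nothing. *)
Lemma mc_cap : exists N, forall i w, B i w <-> B i (cap N w).
Proof.
have [N BN] := mc_power mc; exists N => i w; split; last first.
  by apply: (mc_le mc); apply/mnm_lepP => d; rewrite mnmE geq_minl.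
move=> Bw; have [[d di Nd]|nN] := pselect (exists2 d, d \in G i & (N <= w d)%N).
  apply: (mc_local mc) (BN i d di) => d' _.
  rewrite mulmnE mnm1E mnmE; case: eqVneq => [<-|_] //.
  by rewrite mul1n leq_min Nd leqnn.
apply: (mc_local mc) Bw => d di; rewrite mnmE leq_min leqnn /=.
by case: leqP => // /ltnW Nd; case: nN; exists d.
Qed.

Section OneClass.
Variables (i : 'I_m) (D : {set 'I_n}) (N : nat).
Hypothesis Di : forall d, d \in D -> d \notin G i.
Hypothesis Dj : forall j d d',
  d \in D -> d' \in D -> d \in G j -> d' \in G j -> d = d'.
Hypothesis BN : forall i w, B i w <-> B i (cap N w).

Lemma first_missed_cap w : first_missed i w <-> first_missed i (cap N w).
Proof.
split=> -[nB iB]; split=> [Bw|j ji].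
- exact/nB/((BN _ _).2 Bw).
- exact/(BN _ _).1/iB.
- exact/nB/((BN _ _).1 Bw).
- exact/(BN _ _).2/iB.
Qed.

Lemma first_missed_up w w' : (w <= w')%MM -> agree_off D w w' ->
  first_missed i w -> first_missed i w'.
Proof.
move=> le ww' [nB iB]; split=> [Bw'|j /iB]; last exact: mc_le mc _ _ _ le.
apply: nB; apply: (mc_local mc) Bw' => d di; rewrite ww' //.
by apply/negP => /Di; rewrite di.
Qed.

(** On [G j] the two exponents differ at no more than one variable, so their
meet coincides there with one of them. *)
Lemma first_missed_meet w w' : agree_off D w w' ->
  first_missed i w -> first_missed i w' -> first_missed i (meet_mnm w w').
Proof.
move=> ww' [nB iB] [_ iB']; split=> [Bm|j ji].
  apply: nB; apply: (mc_le mc) Bm.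
  by apply/mnm_lepP => d; rewrite mnmE geq_minl.
have [[d [dD dj wd]]|nd] :=
  pselect (exists d, [/\ d \in D, d \in G j & (w' d < w d)%N]).
  apply: (mc_local mc) (iB' j ji) => e ej; rewrite mnmE leq_min leqnn andbT.
  have [eD|eD] := boolP (e \in D); last by rewrite ww'.
  by rewrite (Dj eD dD ej dj) ltnW.
apply: (mc_local mc) (iB j ji) => e ej; rewrite mnmE leq_min leqnn /=.
have [eD|eD] := boolP (e \in D); last by rewrite ww'.
by rewrite leqNgt; apply/negP => we; apply: nd; exists e.
Qed.

End OneClass.

Lemma components_sdepth (i0 : 'I_m) :
  (((m.-1 + #|F|)%N%:Z)%:E <= sdepth (quot_grading I))%E.
Proof.
have [D DP] := choice component_directions.
have [N BN] := mc_cap.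
pose mnm_of (x : {ffun 'I_n -> 'I_N.+1}) : 'X_{1..n} :=
  [multinom x d : nat | d < n].
pose P (x : 'I_m * {ffun 'I_n -> 'I_N.+1}) :=
  `[< base (first_missed x.1) (D x.1) N (mnm_of x.2) >].
pose a (x : {x | P x}) := mnm_of (val x).2.
pose Z (x : {x | P x}) := base_vars (D (val x).1) N (a x).
have DZ x : (#|D (val x).1| <= #|Z x|)%N.
  by apply/subset_leq_card/finset.subsetUl.
have bP (x : {x | P x}) : base (first_missed (val x).1) (D (val x).1) N (a x).
  by apply/asboolP; exact: (valP x).
apply: (@sdepth_pieces K n I (fun b => forall i, B i b) (mc_ideal mc) _ a Z).
- move=> x b /(piece_base _ _ (bP x)) H.
  have [] : first_missed (val x).1 b; last by move=> nB _ /(_ (val x).1).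
  have [Di Dj _] := DP (val x).1.
  apply: H; first exact: first_missed_cap.
  exact: first_missed_up.
- move=> b /first_missed_exists[i ib]; have [Di Dj _] := DP i.
  have [w wb wp] :=
    base_exists (first_missed_cap i BN) (first_missed_meet Dj) ib.
  pose x := (i, [ffun d => inord (w d)] : {ffun 'I_n -> 'I_N.+1}).
  have xw : mnm_of x.2 = w.
    apply/mnmP => d; rewrite mnmE ffunE inordK // ltnS.
    by case: wb.
  have Px : P x by apply/asboolP; rewrite xw.
  by exists (exist _ x Px); rewrite /Z /a /= xw.
- move=> x y b xb yb; have [Di Dj _] := DP (val x).1.
  have xy : (val x).1 = (val y).1.
    apply: (@first_missed_unique _ _ b).
      apply: piece_base (bP x) xb; first exact: first_missed_cap.
      exact: first_missed_up.
    have [Di' _ _] := DP (val y).1.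
    apply: piece_base (bP y) yb; first exact: first_missed_cap.
    exact: first_missed_up.
  have := bP y; move: yb; rewrite /Z -xy => yb by'.
  have axy := base_unique (bP x) by' xb yb.
  apply/val_inj.
  rewrite [val x]surjective_pairing [val y]surjective_pairing -xy.
  congr pair; apply/ffunP => d; apply/val_inj.
  by move/mnmP/(_ d): axy; rewrite !mnmE.
- have [_ _ kD] := DP i0; apply: leq_trans kD _.
  by rewrite -[leqRHS]card_ord max_card.
- by move=> x; have [_ _ kD] := DP (val x).1; exact: leq_trans kD (DZ x).
Qed.

Lemma components_depth (i0 : 'I_m) :
  (depth (quotmod I) <= ((m.-1 + #|F|)%N%:Z)%:E)%E.
Proof.
have [u [uF uB uG]] := mc_socle mc.
apply: supremum_nat_le => s [sreg smax].
exact: size_regular_seq sreg smax (koszul_class mc uF uB uG i0).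
Qed.

End ComponentsSdepth.

(** * Primary components of a monomial ideal *)

Section PrimaryComponents.
Variables (K : fieldType) (n : nat).
Notation S := {mpoly K[n]}.

Lemma monomial_ideal_msupp (I : idealr S) (f : S) b :
  monomial_ideal I -> f \in (I : {pred S}) -> b \in msupp f ->
  'X_[b] \in (I : {pred S}).
Proof.
move=> [A IA] fI.
have [s [sA fE]] : ideal_span [set 'X_[a] | a in A] f by rewrite -IA.
rewrite fE => /msupp_sum_le /flattenP[_ /mapP[p ps ->]].
rewrite mem_filter /= in ps.
have [a Aa <-] := sA p ps; rewrite (perm_mem (msuppMX _ _)) => /mapP[c _ ->].
rewrite addmC mpolyXD; apply: idealMr.
suff : [set f | f \in (I : {pred S})] 'X_[a] by [].
rewrite IA; exists [:: (1, 'X_[a])]; split=> [q|].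
  by rewrite inE => /eqP ->; exists a.
by rewrite big_seq1 mul1r.
Qed.

(** The radical of a primary ideal is prime, so a monomial in it involves one of
its variables. *)
Lemma radicalX_vars (Q : idealr S) c : primary_ideal Q ->
  ideal_radical Q 'X_[c] -> exists2 d, ideal_radical Q 'X_d & c d != 0%N.
Proof.
move=> prQ; have [k ck] : exists k, mdeg c = k by exists (mdeg c).
elim: k c ck => [|k IH] c ck.
  move/eqP: ck; rewrite mdeg_eq0 => /eqP -> [k].
  by rewrite mpolyX0 expr1n idealr1.
have [d cd] : exists d, c d != 0%N.
  apply: contrapT => nc; move: ck; rewrite mdegE big1 // => d _; apply/eqP.
  by apply: contrapT => /negP cd; apply: nc; exists d.
have cE : c = (U_(d) + (c - U_(d)))%MM.
  rewrite addmC submK //; apply/mnm_lepP => e; rewrite mnm1E.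
  by case: eqVneq => // <-; rewrite lt0n.
rewrite {1}cE mpolyXD => -[l]; rewrite exprMn_comm; last exact: mulrC.
rewrite mulrC => /prQ[H|[l' H]].
  have [|e eQ ce] := IH (c - U_(d))%MM _ (ex_intro _ l H).
    by move: ck; rewrite {1}cE mdegD mdeg1 => -[].
  by exists e => //; apply: contraNN ce; rewrite mnmBE => /eqP ->.
by exists d => //; exists (l * l')%N; rewrite exprM.
Qed.

(** Variables outside the radical are nonzerodivisors, so their exponents can be
cancelled. *)
Lemma primary_local (Q : idealr S) (a b : 'X_{1..n}) : primary_ideal Q ->
  (forall d, ideal_radical Q 'X_d -> (a d <= b d)%N) ->
  'X_[a] \in (Q : {pred S}) -> 'X_[b] \in (Q : {pred S}).
Proof.
move=> prQ ab.
pose a1 : 'X_{1..n} := [multinom minn (a d) (b d) | d < n].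
have a1a : (a1 <= a)%MM by apply/mnm_lepP => d; rewrite mnmE geq_minl.
rewrite -{1}(submK a1a) mpolyXD mulrC => /prQ[H|].
  rewrite -(@submK _ a1 b); first by rewrite mpolyXD; exact: idealMr.
  by apply/mnm_lepP => d; rewrite mnmE geq_minr.
case/(radicalX_vars prQ) => d /ab le; rewrite mnmBE mnmE subn_eq0.
by rewrite leq_min leqnn le.
Qed.

(** The only monomials dividing X_d are 1 and X_d, so a variable of the radical
is one of its minimal generators; hence the sets of variables are disjoint. *)
Lemma decomposition_components (I : idealr S) (m : nat) (Q : 'I_m -> idealr S) :
  monomial_ideal I -> reduced_primary_decomposition I Q ->
  (forall i j : 'I_m, i != j ->
     min_gens (ideal_radical (Q i)) `&`
     min_gens (ideal_radical (Q j)) = set0) ->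
  monomial_components I
    (fun i => [set d | `[< ideal_radical (Q i) 'X_d >]]%SET)
    (fun i => [set a | 'X_[a] \in (Q i : {pred S})]).
Proof.
move=> monI [interQ prQ irrQ _] disjG.
have inG i d : reflect (ideal_radical (Q i) 'X_d)
    (d \in [set d | `[< ideal_radical (Q i) 'X_d >]]%SET).
  by rewrite inE; exact: asboolP.
split.
- move=> f; split=> [fI b bf i /=|fQ].
    exact: (interQ _).1 (monomial_ideal_msupp monI fI bf) i.
  apply/interQ => i; rewrite [f]mpolyE big_seq; apply: rpred_sum => b bf.
  by rewrite -mul_mpolyC; apply: idealMr; exact: fQ.
- move=> i a b ab; apply: primary_local (prQ i) _ => d /inG; exact: ab.
- by move=> i /=; rewrite mpolyX0 idealr1.
- have /choice[k kP] : forall x : 'I_m * 'I_n, exists k,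
      ideal_radical (Q x.1) 'X_(x.2) -> 'X_(x.2) ^+ k \in (Q x.1 : {pred S}).
    move=> x; have [[k kQ]|nQ] := pselect (ideal_radical (Q x.1) 'X_(x.2)).
      by exists k.
    by exists 0%N => /nQ.
  exists (\max_x k x) => i d /inG di /=.
  rewrite -mpolyXn -(subnK (leq_bigmax (i, d))) exprD; apply: idealMr.
  exact: (kP (i, d)).
- move=> i j d /inG di /inG dj; apply/eqP; apply: contraT => ij.
  have gen k : ideal_radical (Q k) 'X_d ->
      min_gens (ideal_radical (Q k)) U_(d)%MM.
    move=> dk; split=> // b bk bd.
    have [e _ be] := radicalX_vars (prQ k) bk.
    have {}bd e' : (b e' <= U_(d)%MM e')%N by move/mnm_lepP: bd.
    have ed : d = e.
      move: (bd e) be; rewrite mnm1E; case: eqVneq => // _.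
      by rewrite leqn0 => /eqP ->.
    apply/mnmP => e'; apply/eqP; rewrite eqn_leq bd /= mnm1E ed.
    by case: eqVneq => // <-; rewrite lt0n.
  have : set0 U_(d)%MM by rewrite -(disjG i j ij); split; exact: gen.
  by [].
(* If no variable is in the radical of [Q j] then I = 0, hence m = 1. *)
- have [|/existsNP[j /forallNP jG]] := pselect (forall i, exists d, d \in
    [set d | `[< ideal_radical (Q i) 'X_d >]]%SET); [by left|right].
  have I0 f : f \in (I : {pred S}) -> f = 0.
    move=> fI; apply/msuppnil0; case E : (msupp f) => [//|b l].
    have bf : b \in msupp f by rewrite E mem_head.
    have bQ := (interQ _).1 (monomial_ideal_msupp monI fI bf) j.
    have : 'X_[0%MM] \in (Q j : {pred S}).
      by apply: primary_local (prQ j) _ bQ => d /inG /(jG d).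
    by rewrite mpolyX0 idealr1.
  have [i Qi0] : exists i, forall f, f \in (Q i : {pred S}) -> f = 0.
    apply: contrapT => nQ.
    have /choice[g gQ] : forall i, exists f, f \in (Q i : {pred S}) /\ f != 0.
      move=> i; apply: contrapT => nf; apply: nQ; exists i => f fQ.
      by apply: contrapT => /eqP f0; apply: nf; exists f.
    have /I0/eqP : \prod_i g i \in (I : {pred S}).
      apply/interQ => i; rewrite (bigD1 i) //= mulrC; apply: idealMr.
      by have [] := gQ i.
    by apply/negP/prodf_neq0 => i _; have [] := gQ i.
  have iE k : k = i.
    apply/eqP; apply: contraT => ki; have [f [fQ]] := irrQ k.
    by rewrite (Qi0 f) ?rpred0 // fQ // eq_sym.
  rewrite -[m]card_ord; apply: (eq_card1 (x := i)) => k.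
  by rewrite !inE (iE k) eqxx.
Qed.

End PrimaryComponents.

Unset Implicit Arguments.

Theorem theorem2p1 (K : fieldType) (n : nat) (I : idealr {mpoly K[n]})
    (m : nat) (Q : 'I_m -> idealr {mpoly K[n]})
    (monI : monomial_ideal I)
    (decI : reduced_primary_decomposition I Q)
    (disjG : forall i j : 'I_m, i != j ->
       min_gens (ideal_radical (Q i)) `&` min_gens (ideal_radical (Q j)) = set0) :
  ((m%:Z - 1)%:E <= sdepth (quot_grading I))%E /\
  (depth (quotmod I) <= sdepth (quot_grading I))%E.
Proof.
have mc := decomposition_components monI decI disjG.
have [i0 _] : exists i : 'I_m, True.
  apply: contrapT => ni; have := idealr1 I; rewrite (_ : _ \in _) //.
  by apply/(rpd_inter decI) => i; case: ni; exists i.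
have sd := components_sdepth mc i0; split; last first.
  exact: le_trans (components_depth mc i0) sd.
apply: le_trans sd; rewrite lee_fin lerBlDr -PoszD lez_nat addn1.
have m_gt0 : (0 < m)%N := leq_ltn_trans (leq0n i0) (ltn_ord i0).
by rewrite -[in leqLHS](prednK m_gt0) ltnS leq_addr.
Qed.
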